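(* Let $\mathbf{i}$ and $\mathbf{j}$ be ideals in $\mathbb{N}$ with $\mathbf{i}\Subset\mathbf{j}$. Then there exist uncountably many ideals $\mathbf{k}$ in $\mathbb{N}$, pairwise incomparable with respect to the strict partial order $\Subset$, each satisfying $\mathbf{i}\Subset\mathbf{k}\Subset\mathbf{j}$.
   Context: $\mathbb{N}=\{1,2,3,\ldots\}$. A set $\mathbf{i}\subseteq 2^{\mathbb{N}}$ is an ideal in $\mathbb{N}$ if (1) $A,B\in\mathbf{i}$ implies $A\cup B\in\mathbf{i}$, and (2) $A\in\mathbf{i}$ and $B\subseteq A$ imply $B\in\mathbf{i}$. For ideals $\mathbf{i},\mathbf{j}$ in $\mathbb{N}$, we write $\mathbf{i}\Subset\mathbf{j}$ ($\mathbf{j}$ is much larger than $\mathbf{i}$) if $\mathbf{i}\subsetneq\mathbf{j}$ and there exists a countable collection $\{D_j\}_{j\in\mathbb{N}}\subseteq\mathbf{i}$ of non-empty pairwise disjoint sets such that $\bigcup_{k\in K}D_k\in\mathbf{j}\setminus\mathbf{i}$ for every infinite subset $K\subseteq\mathbb{N}$. The relation $\Subset$ is a strict partial order on the set of ideals in $\mathbb{N}$. *)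

(* Defs.v *)
From mathcomp Require Import all_boot.
From mathcomp Require Import boolp classical_sets functions cardinality.

Set Implicit Arguments.
Unset Strict Implicit.
Unset Printing Implicit Defensive.

Local Open Scope classical_set_scope.

Definition posnat : Type := {n : nat | (0 < n)%N}.

(* Neither [i !=set0] nor [~ i setT] is required: the empty family and the
   full power set both count as ideals. *)
Definition is_ideal (i : set (set posnat)) : Prop :=
  (forall A B : set posnat, i A -> i B -> i (A `|` B)) /\
  (forall A B : set posnat, i A -> B `<=` A -> i B).

(* [much_smaller i j] is the relation i ⋐ j, "j is much larger than i". *)
Definition much_smaller (i j : set (set posnat)) : Prop :=
  i `<` j /\
  exists D : posnat -> set posnat,
    [/\ forall n, i (D n),
        forall n, D n !=set0,
        trivIset setT D &
        forall K : set posnat, infinite_set K ->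
          (j `\` i) (\bigcup_(k in K) D k)].

Definition incomparable (k l : set (set posnat)) : Prop :=
  ~ much_smaller k l /\ ~ much_smaller l k.

(* Main.v *)
Require Import Defs.
From mathcomp Require Import all_boot.
From mathcomp Require Import boolp classical_sets functions cardinality.

Local Open Scope classical_set_scope.

(** Let [D] be a sequence of blocks witnessing that [j] is much larger than
    [i].  For a set [K] of indices, let [k_K] be the ideal generated by [i] and
    the union [D_K] of the blocks indexed by [K] ([adjoin i (\bigcup_(n in K) D
    n)]).  Since the blocks are disjoint, if [D_L] is in [k_K] then [D_(L \ K)]
    is in [i], which forces [L \ K] to be finite ([notin_adjoin]).

    Hence, if both [K] and its complement are infinite, the blocks indexed by
    [K] witness that [k_K] is much larger than [i], and the blocks outside [K]
    witness that [j] is much larger than [k_K].  Moreover [k_K] is included in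
    [k_L] only if [K \ L] is finite.

    It remains to find uncountably many index sets with pairwise infinite
    differences.  The branches of the binary tree do this: attach to
    [x : nat -> bool] the set of (codes of) its finite nonempty prefixes.
    Distinct branches share only finitely many prefixes, and a branch and its
    bitwise negation share none, so that complements are infinite too.  There
    are uncountably many branches by Cantor's diagonal argument. *)

(** * Infinite and uncountable sets *)

Lemma infinite_preimage (T U : Type) (f : T -> U) (B : set U) :
  injective f -> infinite_set (f @^-1` B) -> infinite_set B.
Proof.
move=> injf + finB; apply; apply: card_le_finite finB.
by apply: card_ge_preimage => a b _ _; apply: injf.
Qed.

Lemma infinite_image (T U : Type) (f : T -> U) (A : set T) :
  injective f -> infinite_set A -> infinite_set (f @` A).
Proof.
move=> injf infA; apply: infinite_preimage injf _.
by apply: sub_infinite_set infA; apply: preimage_image.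
Qed.

Lemma infinite_posnat : infinite_set [set: posnat].
Proof.
pose f n : posnat := exist _ n.+1 (ltn0Sn n).
apply: (@infinite_preimage nat posnat f); last exact: infinite_nat.
by move=> a b [].
Qed.

(** Cantor's diagonal argument: composing [g] with an injection of its range
    into [nat] would give an injection [h] of [nat -> bool] into [nat]. *)
Lemma uncountable_range (T : Type) (g : (nat -> bool) -> T) :
  injective g -> ~ countable (range g).
Proof.
move=> injg /countable_injP[f injf].
pose h x := f (g x).
have injh : injective h.
  by move=> x y /injf; rewrite !inE => /(_ (imageT _ _) (imageT _ _))/injg.
(* [d] disagrees with each [y] at the place [h y], including with itself. *)
pose d n := `[< exists2 y, h y = n & y n = false >].
case dhd : (d (h d)); last first.
  have : d (h d) by apply/asboolP; exists d.
  by rewrite dhd.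
have /asboolP[y /injh ->] : d (h d) by [].
by rewrite dhd.
Qed.

(** * Branches of the binary tree *)

(** Positive lengths leave out the empty prefix, which all branches share. *)
Definition branch (x : nat -> bool) (n : posnat) : posnat :=
  exist _ (pickle (mkseq x (val n))).+1 (ltn0Sn _).

Lemma branch_eq (x y : nat -> bool) (n m : posnat) :
  branch x n = branch y m ->
  n = m /\ forall k, (k < val n)%N -> x k = y k.
Proof.
move=> [] /(pcan_inj pickleK) exy.
have enm : val n = val m by rewrite -(size_mkseq x (val n)) exy size_mkseq.
split=> [|k kn]; first exact: val_inj.
by rewrite -(nth_mkseq false x kn) exy nth_mkseq // -enm.
Qed.

Lemma branch_inj (x : nat -> bool) : injective (branch x).
Proof. by move=> n m /branch_eq[]. Qed.

(** Once [x] and [y] differ at [m], no prefix of [x] longer than [m] is a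
    prefix of [y]. *)
Lemma infinite_branchD (x y : nat -> bool) :
  x <> y -> infinite_set (range (branch x) `\` range (branch y)).
Proof.
move=> neq_xy.
have [m xym] : exists m, x m <> y m.
  by apply: contra_notP neq_xy => /forallNP eqxy; apply/funext => m;
     apply/notP/eqxy.
pose long n : posnat := exist _ (m + n).+1 (ltn0Sn _).
apply: (@infinite_preimage nat _ (branch x \o long)).
  by move=> a b /branch_inj[] /addnI.
apply: sub_infinite_set infinite_nat => n _; split; first exact: imageT.
case=> p _ /esym /branch_eq[_ /(_ m)] /=.
by rewrite ltnS leq_addr => /(_ isT).
Qed.

Lemma branch_negb (x : nat -> bool) (n : posnat) :
  ~ range (branch x) (branch (negb \o x) n).
Proof.
(* prefixes are nonempty, so the first bits can be compared *)
case=> p _ /branch_eq[_ /(_ 0 (valP p))] /=.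
by case: (x 0).
Qed.

(** * Adjoining a set to an ideal *)

(** The ideal generated by [i] and [A], provided that [i] is nonempty. *)
Definition adjoin (i : set (set posnat)) (A : set posnat) : set (set posnat) :=
  [set C | exists2 B, i B & C `<=` B `|` A].

Lemma is_ideal_adjoin (i : set (set posnat)) (A : set posnat) :
  is_ideal i -> is_ideal (adjoin i A).
Proof.
move=> [iU _]; split=> [C C' [B iB CB] [B' iB' CB']|C C' [B iB CB] C'C].
  exists (B `|` B'); first exact: iU.
  by move=> t [/CB|/CB'] []; [left; left|right|left; right|right].
by exists B => //; apply: subset_trans CB.
Qed.

Lemma sub_adjoin (i : set (set posnat)) (A : set posnat) : i `<=` adjoin i A.
Proof. by move=> B iB; exists B => // t; left. Qed.

Lemma mem_adjoin (i : set (set posnat)) (A C : set posnat) :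
  i !=set0 -> C `<=` A -> adjoin i A C.
Proof. by move=> [B iB] CA; exists B => // t /CA; right. Qed.

Lemma adjoin_sub (i j : set (set posnat)) (A : set posnat) :
  is_ideal j -> i `<=` j -> j A -> adjoin i A `<=` j.
Proof. by move=> [jU jS] ij jA C [B /ij jB]; apply: jS; apply: jU. Qed.

(** By disjointness, a set [B] of [i] covering the blocks indexed by [L] up to
    those indexed by [K] must cover all blocks indexed by [L `\` K]; their union would then be in
    [i]. *)
Lemma notin_adjoin (i : set (set posnat)) (D : posnat -> set posnat)
    (K L : set posnat) :
  is_ideal i -> trivIset setT D ->
  (forall M, infinite_set M -> ~ i (\bigcup_(n in M) D n)) ->
  infinite_set (L `\` K) ->
  ~ adjoin i (\bigcup_(n in K) D n) (\bigcup_(n in L) D n).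
Proof.
move=> [_ iS] trivD noti infLK [B iB DL].
apply: (noti _ infLK); apply: iS iB _ => t [n [Ln nKn] Dnt].
have /DL[//|[m Km Dmt]] : (\bigcup_(n in L) D n) t by exists n.
have enm : n = m by apply: trivD => //; exists t.
by case: nKn; rewrite enm.
Qed.

(** The witnessing sequence is [D] reindexed by [e]; the proper inclusion comes
    for free, as the union of the whole sequence is in [j] but not in [i]. *)
Lemma much_smaller_reindex (i j : set (set posnat)) (D : posnat -> set posnat)
    (e : posnat -> posnat) :
  i `<=` j -> injective e ->
  (forall n, i (D n)) -> (forall n, D n !=set0) -> trivIset setT D ->
  (forall M, infinite_set M -> M `<=` range e ->
     (j `\` i) (\bigcup_(n in M) D n)) ->
  much_smaller i j.
Proof.
move=> ij inje iD D0 trivD jiD.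
have jiDe M : infinite_set M -> (j `\` i) (\bigcup_(n in M) D (e n)).
  move=> infM; rewrite -(bigcup_image M e D).
  by apply: jiD; [exact: infinite_image|apply: image_subset].
split.
  split=> // ji; have [jD] := jiDe _ infinite_posnat.
  by apply; apply: ji.
exists (D \o e); split=> // [n|n|n m _ _ Dnm].
- exact: iD.
- exact: D0.
- by apply: inje; apply: trivD.
Qed.

Theorem proposition3p3 (i j : set (set posnat))
  (hi : is_ideal i) (hj : is_ideal j) (hij : much_smaller i j) :
  exists S : set (set (set posnat)),
    [/\ ~ countable S,
        forall k, S k ->
          [/\ is_ideal k, much_smaller i k & much_smaller k j] &
        forall k l, S k -> S l -> k <> l -> incomparable k l].
Proof.
have [[ij _] [D [iD D0 trivD jiD]]] := hij.
have jD M : infinite_set M -> j (\bigcup_(n in M) D n) by move=> /jiD[].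
have noti M : infinite_set M -> ~ i (\bigcup_(n in M) D n) by move=> /jiD[].
have i0 : i !=set0 by exists (D (branch xpred0 (exist _ 1 isT))).
pose A x := \bigcup_(n in range (branch x)) D n.
pose k x := adjoin i (A x).
have inf_branch x : infinite_set (range (branch x)).
  exact: infinite_image (@branch_inj x) infinite_posnat.
have k_sub x y : k x `<=` k y -> x = y.
  move=> kxy; apply: contrapT => /infinite_branchD infD.
  have : k y (A x) by apply: kxy; apply: mem_adjoin.
  exact: notin_adjoin infD.
exists (range k); split.
- apply: uncountable_range => x y kxy.
  by apply: k_sub; rewrite kxy.
- move=> _ [x _ <-]; split; first exact: is_ideal_adjoin.
  + apply: (@much_smaller_reindex _ _ D (branch x)) => //.
    * exact: sub_adjoin.
    * exact: branch_inj.
    * move=> M infM Mx; split; last exact: noti.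
      by apply: mem_adjoin => //; apply: bigcup_subset.
  + (* the blocks along the opposite branch all lie outside [A x] *)
    apply: (@much_smaller_reindex _ _ D (branch (negb \o x))) => //.
    * by apply: adjoin_sub => //; apply: jD.
    * exact: branch_inj.
    * by move=> n; apply: sub_adjoin.
    * move=> M infM Mx; split; first exact: jD.
      apply: notin_adjoin => //; apply: sub_infinite_set infM => n Mn.
      by split=> //; have [p _ <-] := Mx _ Mn; apply: branch_negb.
- move=> _ _ [x _ <-] [y _ <-] kxy.
  by split=> -[[/k_sub exy _] _]; apply: kxy; rewrite exy.
Qed.
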